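(* There exist groups of bounded operators $\mathcal T=(T(t))_{t\in\mathbb R}\subset\mathcal L(\mathbb C)$ and $\mathcal S=(S(t))_{t\in\mathbb R}\subset\mathcal L(\mathbb C)$ such that neither $\mathcal T$ nor $\mathcal S$ is locally bounded (hence they are not in $\mathcal{SQC}(\mathbb C)$) and such that $\mathcal T\otimes\mathcal S=(T(t)\otimes S(t))_{t\in\mathbb R}$ is the identity group on $\mathbb C\otimes\mathbb C$.
   Context: $\mathcal L(H)$ denotes the bounded operators on the Hilbert space $H$. A group of bounded operators on $H$ is a family $(T(t))_{t\in\mathbb R}\subset\mathcal L(H)$ with $T(0)=I$ and $T(s+t)=T(s)T(t)$ for all $s,t\in\mathbb R$ (no measurability or continuity assumed). Locally bounded means that $t\mapsto\|T(t)\|$ is bounded on compact sets. A semigroup $(T(t))_{t\ge0}\subset\mathcal L(H)$ belongs to $\mathcal{SQC}(H)$ if there are an invertible $R\in\mathcal L(H)$ and $\lambda\in\mathbb R$ with $\|RT(t)R^{-1}\|\le e^{\lambda t}$ for all $t\ge0$; for a group, membership in $\mathcal{SQC}(H)$ refers to the semigroup obtained by restricting to $t\ge0$. *)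

(* Defs.v *)
From Stdlib Require Import Reals Lra List ClassicalEpsilon FunctionalExtensionality.
From Coquelicot Require Import Coquelicot.
Open Scope R_scope.

(** The Hilbert norm is the one carried by the Coquelicot structure, so that
    completeness is completeness for the inner product norm. *)
Record Hilbert := mkHilbert {
  hilbert_sort :> CompleteNormedModule C_AbsRing;
  inner : hilbert_sort -> hilbert_sort -> C;
  inner_plus_l : forall x y z : hilbert_sort,
    inner (plus x y) z = Cplus (inner x z) (inner y z);
  inner_scal_l : forall (a : C) (x y : hilbert_sort),
    inner (scal a x) y = Cmult a (inner x y);
  inner_conj : forall x y : hilbert_sort, inner y x = Cconj (inner x y);
  inner_norm : forall x : hilbert_sort, inner x x = RtoC (norm x ^ 2)
}.
Arguments inner {h} x y.

(** Elements of L(H) are maps [A : H -> H] satisfying Coquelicot's [is_linear],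
    which includes the bound [norm (A x) <= M * norm x]. *)

(** [Lub_Rbar] is finite, hence equal to its [real] part, for bounded [A]. *)
Definition opnorm {H : Hilbert} (A : H -> H) : R :=
  real (Lub_Rbar (fun r => exists x : H, norm x <= 1 /\ r = norm (A x))).

Definition is_group {H : Hilbert} (T : R -> H -> H) : Prop :=
  (forall t, is_linear (T t)) /\
  (forall x, T 0 x = x) /\
  (forall s t x, T (s + t) x = T s (T t x)).

(** A semigroup is encoded by a family over [R] whose values at negative times
    are irrelevant; restricting a group to [t >= 0] then leaves [T] unchanged. *)
Definition is_semigroup {H : Hilbert} (T : R -> H -> H) : Prop :=
  (forall t, 0 <= t -> is_linear (T t)) /\
  (forall x, T 0 x = x) /\
  (forall s t x, 0 <= s -> 0 <= t -> T (s + t) x = T s (T t x)).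

Definition locally_bounded {H : Hilbert} (T : R -> H -> H) : Prop :=
  forall X : R -> Prop, compact X ->
    exists M : R, forall t, X t -> opnorm (T t) <= M.

Definition SQC {H : Hilbert} (T : R -> H -> H) : Prop :=
  is_semigroup T /\
  exists Q Qinv : H -> H,
    is_linear Q /\ is_linear Qinv /\
    (forall x, Qinv (Q x) = x) /\ (forall x, Q (Qinv x) = x) /\
    exists lambda : R, forall t, 0 <= t ->
      opnorm (fun x => Q (T t (Qinv x))) <= exp (lambda * t).

(** A Hilbert space tensor product of [H1] and [H2], determined up to a unique
    unitary compatible with [tens]; [tens_dense] says that the finite sums of
    elementary tensors are dense. *)
Record HilbertTensor (H1 H2 : Hilbert) := mkHilbertTensor {
  tens_space :> Hilbert;
  tens : H1 -> H2 -> tens_space;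
  tens_plus_l : forall x x' y, tens (plus x x') y = plus (tens x y) (tens x' y);
  tens_plus_r : forall x y y', tens x (plus y y') = plus (tens x y) (tens x y');
  tens_scal_l : forall (a : C) x y, tens (scal a x) y = scal a (tens x y);
  tens_scal_r : forall (a : C) x y, tens x (scal a y) = scal a (tens x y);
  tens_inner : forall x y x' y',
    inner (tens x y) (tens x' y') = Cmult (inner x x') (inner y y');
  tens_dense : forall (z : tens_space) (eps : R), 0 < eps ->
    exists l : list (H1 * H2),
      norm (minus z (fold_right (fun p s => plus (tens (fst p) (snd p)) s) zero l))
        < eps
}.
Arguments tens_space {H1 H2} h.
Arguments tens {H1 H2} h x y.

Definition is_tensor_op {H1 H2 : Hilbert} (K : HilbertTensor H1 H2)
    (A : H1 -> H1) (B : H2 -> H2) (D : K -> K) : Prop :=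
  is_linear D /\ forall x y, D (tens K x y) = tens K (A x) (B y).

(** The operator [A] tensor [B] on [K]; see [tensor_op_unique] and [C_tensor_op_spec]. *)
Definition tensor_op {H1 H2 : Hilbert} (K : HilbertTensor H1 H2)
    (A : H1 -> H1) (B : H2 -> H2) : K -> K :=
  epsilon (inhabits (fun _ => zero)) (is_tensor_op K A B).

Lemma minus_cancel {G : AbelianGroup} (a b w : G) :
  plus (minus a w) (opp (minus b w)) = plus a (opp b).
Proof.
rewrite opp_minus. unfold minus.
now rewrite <- plus_assoc, (plus_assoc (opp w)), plus_opp_l, plus_zero_l.
Qed.

Lemma linear_eq_dense {K : AbsRing} {U V : NormedModule K} (D D' : U -> V) :
  is_linear D -> is_linear D' ->
  (forall (z : U) (eps : R), 0 < eps ->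
     exists w, D w = D' w /\ norm (minus z w) < eps) ->
  forall z, D z = D' z.
Proof.
intros LD LD' Hd z.
destruct (linear_norm D LD) as [M [HM HD]].
destruct (linear_norm D' LD') as [M' [HM' HD']].
apply plus_reg_r with (opp (D' z)).
rewrite plus_opp_r.
apply norm_eq_zero.
apply Rle_antisym; [|apply norm_ge_0].
apply le_epsilon; intros eps Heps.
destruct (Hd z (eps / (M + M'))) as [w [Ew Hw]].
{ apply Rdiv_lt_0_compat; lra. }
assert (E : plus (D (minus z w)) (opp (D' (minus z w))) = plus (D z) (opp (D' z))).
{ rewrite (linear_minus D z w LD), (linear_minus D' z w LD'), Ew.
  exact (minus_cancel (G := V) _ _ _). }
refine (Rle_trans _ _ _ (Req_le _ _ (f_equal norm (eq_sym E))) _).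
apply Rle_trans with (1 := norm_triangle _ _).
rewrite norm_opp.
specialize (HD (minus z w)). specialize (HD' (minus z w)).
assert ((M + M') * norm (minus z w) <= (M + M') * (eps / (M + M'))).
{ apply Rmult_le_compat_l; lra. }
replace ((M + M') * (eps / (M + M'))) with eps in H by (field; lra).
rewrite Rmult_plus_distr_r in H.
rewrite Rplus_0_l.
apply Rle_trans with (2 := H).
exact (Rplus_le_compat _ _ _ _ HD HD').
Qed.

Lemma is_tensor_op_unique {H1 H2 : Hilbert} (K : HilbertTensor H1 H2) A B D D' :
  is_tensor_op K A B D -> is_tensor_op K A B D' -> forall z, D z = D' z.
Proof.
intros [LD HD] [LD' HD'].
apply (linear_eq_dense D D' LD LD').
intros z eps Heps.
destruct (tens_dense _ _ K z eps Heps) as [l Hl].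
eexists; split; [|exact Hl].
clear Hl; induction l as [|[x y] l IH]; simpl.
- exact (eq_trans (linear_zero D LD) (eq_sym (linear_zero D' LD'))).
- refine (eq_trans (linear_plus D LD _ _)
    (eq_trans _ (eq_sym (linear_plus D' LD' _ _)))).
  exact (f_equal2 plus (eq_trans (HD x y) (eq_sym (HD' x y))) IH).
Qed.

Lemma tensor_op_unique {H1 H2 : Hilbert} (K : HilbertTensor H1 H2) A B D :
  is_tensor_op K A B D -> tensor_op K A B = D.
Proof.
intros HD. apply functional_extensionality.
apply (is_tensor_op_unique K A B); [|exact HD].
unfold tensor_op. apply epsilon_spec. now exists D.
Qed.

Definition C_inner (x y : C_CompleteNormedModule) : C := Cmult x (Cconj y).

Lemma C_inner_plus_l (x y z : C_CompleteNormedModule) :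
  C_inner (plus x y) z = Cplus (C_inner x z) (C_inner y z).
Proof. exact (Cmult_plus_distr_r x y (Cconj z)). Qed.

Lemma C_inner_scal_l (a : C) (x y : C_CompleteNormedModule) :
  C_inner (scal a x) y = Cmult a (C_inner x y).
Proof. exact (eq_sym (Cmult_assoc a x (Cconj y))). Qed.

Lemma C_inner_conj (x y : C_CompleteNormedModule) :
  C_inner y x = Cconj (C_inner x y).
Proof.
unfold C_inner; destruct x, y; apply injective_projections; simpl; ring.
Qed.

Lemma C_inner_norm (x : C_CompleteNormedModule) :
  C_inner x x = RtoC (norm x ^ 2).
Proof. exact (eq_sym (Cmod2_conj x)). Qed.

Definition C_Hilbert : Hilbert :=
  mkHilbert C_CompleteNormedModule C_inner
    C_inner_plus_l C_inner_scal_l C_inner_conj C_inner_norm.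

(** [HilbertTensor C_Hilbert C_Hilbert] is inhabited. *)
Definition C_tensor : HilbertTensor C_Hilbert C_Hilbert.
Proof.
refine (mkHilbertTensor C_Hilbert C_Hilbert C_Hilbert Cmult _ _ _ _ _ _).
- exact Cmult_plus_distr_r.
- exact Cmult_plus_distr_l.
- intros a x y. exact (eq_sym (Cmult_assoc a x y)).
- intros a x y. change (Cmult x (Cmult a y) = Cmult a (Cmult x y)). ring.
- intros [] [] [] []; apply injective_projections; simpl; ring.
- intros z eps Heps. exists ((z, RtoC 1) :: nil); simpl.
  rewrite plus_zero_r.
  replace (Cmult z (RtoC 1)) with (z : C) by (symmetry; apply Cmult_1_r).
  rewrite minus_eq_zero.
  exact (Rle_lt_trans _ _ _
    (Req_le _ _ (norm_zero (V := C_CompleteNormedModule))) Heps).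
Defined.

(** Every pair of bounded operators on [C] does have a tensor product. *)
Lemma C_tensor_op_spec (K : HilbertTensor C_Hilbert C_Hilbert)
    (A B : C_Hilbert -> C_Hilbert) :
  is_linear A -> is_linear B -> is_tensor_op K A B (tensor_op K A B).
Proof.
intros LA LB.
unfold tensor_op; apply epsilon_spec.
assert (E : forall F : C_Hilbert -> C_Hilbert, is_linear F ->
  forall x : C_Hilbert, F x = scal (F (RtoC 1) : C) x).
{ intros F LF x.
  refine (eq_trans (f_equal F (eq_sym (Cmult_1_r x))) _).
  refine (eq_trans (linear_scal F LF (x : C) (RtoC 1)) _).
  exact (Cmult_comm x (F (RtoC 1))). }
exists (fun z => scal (Cmult (A (RtoC 1)) (B (RtoC 1))) z); split.
- exact (is_linear_scal_r (V := K) _ Cmult_comm).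
- intros x y. rewrite (E A LA x), (E B LB y), tens_scal_l, tens_scal_r.
  exact (eq_sym (scal_assoc (V := K) _ _ _)).
Qed.

(* Main.v *)
Require Import Defs.
From Stdlib Require Import Reals.
From Coquelicot Require Import Coquelicot.
From Stdlib Require Import Lra Lia Arith.Wf_nat QArith Qreals Classical
  IndefiniteDescription FunctionalExtensionality.
From mathcomp Require classical_sets.
Open Scope R_scope.

(** A bounded operator on [C] is multiplication by a scalar, so a group on [C]
    is a homomorphism from [(R, +)] to the nonzero scalars.  Take
    [T t = exp (f t)] and [S t = exp (- f t)] for an additive [f : R -> R].
    Both are groups, and their tensor product multiplies by
    [exp (f t) * exp (- f t) = 1].  What remains is to find an additive [f] that
    is unbounded above and below on a bounded interval.

    [rational_projection_exists] provides a [Q]-linear map [f : R -> Q] with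
    [f 1 = 1], the projection along a maximal [Q]-subspace that misses [1].
    Such a map cannot be injective, because it is the identity on [Q] and [R]
    has irrational elements; it therefore kills some [v > 0].  Translating the
    integer [n] by a multiple of [v] brings it between [0] and [v] without
    changing the value of [f], so [f] takes every integer value there
    ([projection_integer_values]).

    The operator norm of a scalar operator is the modulus of the scalar, so such
    an [f] violates local boundedness on the segment from [0] to [v].  It also
    excludes [SQC]: scalar operators commute with the similarity, so
    quasi-contractivity would give [f t <= lambda * t] for all [t >= 0]. *)

(** * An irrational number *)

(** Infinite descent: a solution [(n, m)] yields the smaller solution
    [(m, n / 2)]. *)
Lemma square_double_square (n m : nat) : (n * n = 2 * (m * m) -> m = 0)%nat.
Proof.
revert m; induction n as [n IH] using lt_wf_ind; intros m E.
destruct (Nat.eq_dec m 0) as [|Hm]; [assumption|].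
destruct (Nat.Even_or_Odd n) as [[k Hk]|[k Hk]]; [|nia].
assert (k = 0)%nat by (apply (IH m); nia).
nia.
Qed.

Lemma sqrt2_irrational (q : Q) : Q2R q <> sqrt 2.
Proof.
intros E.
assert (E2 : Q2R (q * q) = Q2R 2).
{ rewrite Q2R_mult, E, sqrt_sqrt by lra. unfold Q2R; simpl; lra. }
apply eqR_Qeq in E2.
destruct q as [a b]; unfold Qeq in E2; simpl in E2.
assert (Pos.to_nat b = 0)%nat; [|lia].
apply (square_double_square (Z.abs_nat a)).
nia.
Qed.

(** * A rational-valued linear map on the real line *)

Definition Q_subspace (V : R -> Prop) : Prop :=
  V 0 /\ forall q x y, V x -> V y -> V (Q2R q * x + y).

Definition Q_linear (f : R -> R) : Prop :=
  forall q x y, f (Q2R q * x + y) = Q2R q * f x + f y.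

(** Zorn's lemma is applied to the sets that are empty or a subspace, because
    the union of the empty chain is empty. *)
Lemma maximal_subspace_avoiding_one :
  exists V, Q_subspace V /\ ~ V 1 /\
    forall W, Q_subspace W -> (forall x, V x -> W x) -> ~ W 1 ->
      forall x, W x -> V x.
Proof.
destruct (classical_sets.Zorn_bigcup
  (P := fun V : R -> Prop => (forall x, V x -> Q_subspace V) /\ ~ V 1))
  as [V [[HV V1] Vmax]].
{ intros F HF tot; split.
  - intros x [X FX Xx].
    destruct (proj1 (HF X FX) x Xx) as [X0 _].
    split; [now exists X|].
    intros q y z [Y FY Yy] [Z FZ Zz].
    destruct (tot Y Z FY FZ) as [YZ|ZY].
    + exists Z; [assumption|].
      destruct (proj1 (HF Z FZ) z Zz) as [_ clos].
      now apply clos; [apply YZ|].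
    + exists Y; [assumption|].
      destruct (proj1 (HF Y FY) y Yy) as [_ clos].
      now apply clos; [|apply ZY].
  - intros [X FX X1]. now apply (HF X FX). }
assert (Hmax : forall W, Q_subspace W -> (forall x, V x -> W x) -> ~ W 1 ->
  forall x, W x -> V x).
{ intros W HW VW W1 x Wx.
  apply NNPP; intros nVx.
  apply (Vmax W); [|now split].
  split; [exact VW|].
  intros WV; apply nVx, WV, Wx. }
exists V; split; [|now split].
(* [V] is not empty because the zero subspace also avoids [1]. *)
destruct (classic (exists x, V x)) as [[x Vx]|empty]; [now apply (HV x)|].
exfalso; apply empty; exists 0.
apply (Hmax (fun x => x = 0)).
- split; [reflexivity|]. intros q x y -> ->. ring.
- intros x Vx; exfalso; apply empty; now exists x.
- exact R1_neq_R0.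
- reflexivity.
Qed.

(** By maximality, adjoining any [x] outside [V] to [V] reaches [1], so
    [R = V + Q]; the sum is direct because [1] is not in [V].  The map is the
    projection onto [Q]. *)
Lemma rational_projection_exists :
  exists f, Q_linear f /\ f 1 = 1 /\ forall x, exists q, f x = Q2R q.
Proof.
destruct maximal_subspace_avoiding_one as [V [[V0 clos] [V1 Vmax]]].
assert (Vscal : forall q x, V x -> V (Q2R q * x)).
{ intros q x Vx. rewrite <- (Rplus_0_r (Q2R q * x)). now apply clos. }
assert (ex : forall x, exists q, V (x - Q2R q)).
{ intros x.
  destruct (classic (V x)) as [Vx|nVx].
  { exists 0%Q. now rewrite RMicromega.Q2R_0, Rminus_0_r. }
  assert (W1 : exists q, V (1 - Q2R q * x)).
  { apply NNPP; intros nW1; apply nVx.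
    apply (Vmax (fun y => exists q, V (y - Q2R q * x))).
    - split.
      + exists 0%Q. now rewrite RMicromega.Q2R_0, Rmult_0_l, Rminus_0_r.
      + intros q y z [r Hy] [s Hz]. exists (q * r + s)%Q.
        replace (Q2R q * y + z - Q2R (q * r + s) * x)
          with (Q2R q * (y - Q2R r * x) + (z - Q2R s * x))
          by (rewrite Q2R_plus, Q2R_mult; ring).
        now apply clos.
    - intros y Vy. exists 0%Q.
      now rewrite RMicromega.Q2R_0, Rmult_0_l, Rminus_0_r.
    - exact nW1.
    - exists 1%Q. rewrite RMicromega.Q2R_1.
      now replace (x - 1 * x) with 0 by ring. }
  destruct W1 as [q Hq].
  assert (nq : ~ (q == 0)%Q).
  { intros q0; apply V1.
    apply Qeq_eqR in q0; rewrite RMicromega.Q2R_0 in q0.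
    now replace 1 with (1 - Q2R q * x) by (rewrite q0; ring). }
  assert (Q2R q <> 0).
  { rewrite <- RMicromega.Q2R_0. intros E; now apply nq, eqR_Qeq. }
  exists (/ q)%Q. rewrite Q2R_inv by assumption.
  replace (x - / Q2R q) with (Q2R (- / q) * (1 - Q2R q * x))
    by (rewrite Q2R_opp, Q2R_inv by assumption; now field).
  now apply Vscal. }
assert (uniq : forall x q r, V (x - Q2R q) -> V (x - Q2R r) -> Q2R q = Q2R r).
{ intros x q r Hq Hr.
  apply NNPP; intros ne; apply V1.
  assert (nqr : ~ (r - q == 0)%Q).
  { intros E; apply Qeq_eqR in E.
    rewrite Q2R_minus, RMicromega.Q2R_0 in E. lra. }
  assert (E : Q2R (/ (r - q)) = / (Q2R r - Q2R q))
    by now rewrite Q2R_inv, Q2R_minus.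
  replace 1 with (Q2R (/ (r - q)) * (Q2R (-1) * (x - Q2R r) + (x - Q2R q))).
  - now apply Vscal, clos.
  - rewrite E. replace (Q2R (-1)) with (-1) by (unfold Q2R; simpl; lra).
    field; lra. }
destruct (functional_choice _ ex) as [c Hc].
exists (fun x => Q2R (c x)); split; [|split].
- intros q x y.
  rewrite <- Q2R_mult, <- Q2R_plus.
  apply (uniq (Q2R q * x + y)); [apply Hc|].
  replace (Q2R q * x + y - Q2R (q * c x + c y))
    with (Q2R q * (x - Q2R (c x)) + (y - Q2R (c y)))
    by (rewrite Q2R_plus, Q2R_mult; ring).
  apply clos; apply Hc.
- rewrite <- RMicromega.Q2R_1 at 2.
  apply (uniq 1); [apply Hc|].
  now rewrite RMicromega.Q2R_1, Rminus_diag.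
- intros x; now exists (c x).
Qed.

Lemma Q_linear_additive (f : R -> R) :
  Q_linear f -> forall x y, f (x + y) = f x + f y.
Proof.
intros Hf x y.
generalize (Hf 1%Q x y); rewrite RMicromega.Q2R_1, !Rmult_1_l; auto.
Qed.

Lemma Q_linear_Q2R (f : R -> R) :
  Q_linear f -> forall q x, f (Q2R q * x) = Q2R q * f x.
Proof.
intros Hf q x.
assert (f0 : f 0 = 0).
{ generalize (Q_linear_additive f Hf 0 0); rewrite Rplus_0_r; lra. }
now rewrite <- (Rplus_0_r (Q2R q * x)), Hf, f0, Rplus_0_r.
Qed.

Lemma Q2R_inject_Z (k : Z) : Q2R (inject_Z k) = IZR k.
Proof. unfold Q2R; simpl; lra. Qed.

(** The real [sqrt 2] and the rational [f (sqrt 2)] are distinct and have the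
    same image, so their difference lies in the kernel. *)
Lemma projection_kernel (f : R -> R) :
  Q_linear f -> f 1 = 1 -> (forall x, exists q, f x = Q2R q) ->
  exists v, 0 < v /\ f v = 0.
Proof.
intros Hf f1 rat.
destruct (rat (sqrt 2)) as [q Hq].
assert (fw : f (sqrt 2 - Q2R q) = 0).
{ replace (sqrt 2 - Q2R q) with (Q2R (- q) * 1 + sqrt 2)
    by (rewrite Q2R_opp; ring).
  rewrite Hf, f1, Hq, Q2R_opp. ring. }
destruct (Rtotal_order (sqrt 2) (Q2R q)) as [lt|[eq|gt]].
- exists (Q2R (-1) * (sqrt 2 - Q2R q)); split.
  + replace (Q2R (-1)) with (-1) by (unfold Q2R; simpl; lra). lra.
  + now rewrite Q_linear_Q2R, fw, Rmult_0_r.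
- now destruct (sqrt2_irrational q).
- exists (sqrt 2 - Q2R q); split; [lra|assumption].
Qed.

(** The remainder of [n] modulo a period [v] has the same image as [n]. *)
Lemma projection_integer_values (f : R -> R) (v : R) :
  Q_linear f -> f 1 = 1 -> 0 < v -> f v = 0 ->
  forall n : Z, exists t, 0 <= t < v /\ f t = IZR n.
Proof.
intros Hf f1 v0 fv n.
destruct (base_Int_part (IZR n / v)) as [lo hi].
set (k := Int_part (IZR n / v)) in *.
exists (Q2R (inject_Z (- k)) * v + Q2R (inject_Z n) * 1); split.
- rewrite !Q2R_inject_Z, opp_IZR.
  replace (- IZR k * v + IZR n * 1) with ((IZR n / v - IZR k) * v)
    by (field; lra).
  nra.
- rewrite Hf, fv, (Q_linear_Q2R f Hf), f1, !Q2R_inject_Z. ring.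
Qed.

(** * Scalar groups on the complex line *)

Definition scalar_group (g : R -> R) (t : R) (x : C_Hilbert) : C_Hilbert :=
  scal (RtoC (exp (g t)) : C) x.

Lemma C_scal_linear (a : C) : is_linear (fun x : C_Hilbert => scal a x).
Proof. exact (is_linear_scal_r (V := C_Hilbert) a Cmult_comm). Qed.

Lemma opnorm_C_scal (a : C) : opnorm (fun x : C_Hilbert => scal a x) = Cmod a.
Proof.
unfold opnorm.
rewrite (is_lub_Rbar_unique _ (Finite (Cmod a))); [reflexivity|].
split.
- intros r [x [Hx ->]].
  change (Cmod (Cmult a x) <= Cmod a); change (Cmod x <= 1) in Hx.
  rewrite Cmod_mult.
  generalize (Cmod_ge_0 a); nra.
- intros b Hb; apply Hb.
  exists (RtoC 1); split.
  + change (Cmod 1 <= 1). rewrite Cmod_1. lra.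
  + change (Cmod a = Cmod (Cmult a 1)). now rewrite Cmult_1_r.
Qed.

Lemma opnorm_scalar_group (g : R -> R) (t : R) :
  opnorm (scalar_group g t) = exp (g t).
Proof.
unfold scalar_group; rewrite opnorm_C_scal, Cmod_R.
apply Rabs_pos_eq, Rlt_le, exp_pos.
Qed.

Lemma scalar_group_is_group (g : R -> R) :
  (forall s t, g (s + t) = g s + g t) -> is_group (scalar_group g).
Proof.
intros Hg; split; [|split].
- intros t; apply C_scal_linear.
- intros x; unfold scalar_group.
  replace (g 0) with 0 by (generalize (Hg 0 0); rewrite Rplus_0_r; lra).
  rewrite exp_0. exact (Cmult_1_l x).
- intros s t x; unfold scalar_group.
  rewrite Hg, exp_plus, RtoC_mult.
  exact (eq_sym (Cmult_assoc _ _ x)).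
Qed.

Definition unbounded_on_segment (g : R -> R) : Prop :=
  exists v, forall M, exists t, 0 <= t <= v /\ M < g t.

Lemma scalar_group_not_locally_bounded (g : R -> R) :
  unbounded_on_segment g -> ~ locally_bounded (scalar_group g).
Proof.
intros [v Hv] LB.
destruct (LB _ (compact_P3 0 v)) as [M HM].
destruct (Hv M) as [t [Ht Mt]].
specialize (HM t Ht); rewrite opnorm_scalar_group in HM.
generalize (exp_ineq1_le (g t)); lra.
Qed.

(** A similarity leaves scalar operators unchanged, so the quasi-contractive
    bound would apply to the group itself, and [g] would lie below a linear
    function on the half-line. *)
Lemma scalar_group_not_SQC (g : R -> R) :
  unbounded_on_segment g -> ~ SQC (scalar_group g).
Proof.
intros [v Hv] [_ [P [Pinv [LP [_ [_ [PK [lambda Hl]]]]]]]].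
destruct (Hv (Rabs lambda * v)) as [t [Ht Mt]].
specialize (Hl t (proj1 Ht)).
replace (fun x => P (scalar_group g t (Pinv x))) with (scalar_group g t) in Hl.
- rewrite opnorm_scalar_group in Hl.
  assert (lt : lambda * t < g t)
    by (generalize (Rle_abs lambda) (Rabs_pos lambda); nra).
  apply exp_increasing in lt; lra.
- apply functional_extensionality; intros x; unfold scalar_group.
  rewrite (linear_scal P LP). now rewrite PK.
Qed.

Lemma scalar_group_tensor_opp (g : R -> R)
    (K : HilbertTensor C_Hilbert C_Hilbert) (t : R) (z : K) :
  tensor_op K (scalar_group g t) (scalar_group (fun s => - g s) t) z = z.
Proof.
rewrite (tensor_op_unique K _ _ (fun z => z)); [reflexivity|].
split; [apply is_linear_id|].
intros x y; unfold scalar_group.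
rewrite tens_scal_l, tens_scal_r.
rewrite (scal_assoc (V := K)).
change (tens K x y = scal (Cmult (exp (g t)) (exp (- g t))) (tens K x y)).
rewrite <- RtoC_mult, <- exp_plus, Rplus_opp_r, exp_0.
exact (eq_sym (scal_one (V := K) _)).
Qed.

Theorem proposition7p6 :
  exists T S : R -> C_Hilbert -> C_Hilbert,
    is_group T /\ is_group S /\
    ~ locally_bounded T /\ ~ locally_bounded S /\
    ~ SQC T /\ ~ SQC S /\
    forall (K : HilbertTensor C_Hilbert C_Hilbert) (t : R) (z : K),
      tensor_op K (T t) (S t) z = z.
Proof.
destruct rational_projection_exists as [f [Hf [f1 rat]]].
destruct (projection_kernel f Hf f1 rat) as [v [v0 fv]].
assert (vals := projection_integer_values f v Hf f1 v0 fv).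
assert (add := Q_linear_additive f Hf).
assert (up_f : unbounded_on_segment f).
{ exists v; intros M.
  destruct (vals (up M)) as [t [Ht E]].
  exists t; split; [lra|]. rewrite E. apply archimed. }
assert (up_nf : unbounded_on_segment (fun s => - f s)).
{ exists v; intros M.
  destruct (vals (- up M)%Z) as [t [Ht E]].
  exists t; split; [lra|]. rewrite E, opp_IZR, Ropp_involutive.
  apply archimed. }
exists (scalar_group f), (scalar_group (fun s => - f s)).
split; [now apply scalar_group_is_group|].
split; [apply scalar_group_is_group; intros s t; rewrite add; ring|].
split; [now apply scalar_group_not_locally_bounded|].
split; [now apply scalar_group_not_locally_bounded|].
split; [now apply scalar_group_not_SQC|].
split; [now apply scalar_group_not_SQC|].
apply scalar_group_tensor_opp.
Qed.
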